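(* Let $k$ be a $c_0$-universal kernel on $\mathbb{X}$. Let $\tilde P_1,\tilde P_2$ be random probability measures on $\mathbb{X}$, defined on the same probability space, such that for $i=1,2$, $\tilde P_i$ is almost surely discrete and, for any fixed atom $z_i$ of $\tilde P_i$ and any $\varepsilon>0$, $\mathbb{P}\big(\tilde P_i(\{z_i\})<\varepsilon\big)>0$. Then $\mathrm{Corr}_k(\tilde P_1,\tilde P_2)=1$ if and only if $\tilde P_1=\tilde P_2$ almost surely.
   Context: $\mathbb{X}$ is a locally compact Polish space with Borel $\sigma$-algebra $\mathcal{X}$. $\mathcal{M}_b(\mathbb{X})$ is the space of bounded (finite) signed measures on $\mathbb{X}$ and $\mathcal{P}(\mathbb{X})$ the subset of probability measures, both with the $\sigma$-algebra generated by the evaluation maps $\xi\mapsto\xi(A)$, $A\in\mathcal{X}$. A kernel on $\mathbb{X}$ is a measurable function $k:\mathbb{X}\times\mathbb{X}\to\mathbb{R}$ that is bounded, symmetric and positive-definite ($\sum_{i,j=1}^m a_ia_jk(x_i,x_j)\ge 0$ for all $m$, $x_i\in\mathbb{X}$, $a_i\in\mathbb{R}$). $\mathbb{H}_k$ is its reproducing kernel Hilbert space. The kernel mean embedding of $\xi\in\mathcal{M}_b(\mathbb{X})$ is $\mu_k(\xi)\in\mathbb{H}_k$, $\mu_k(\xi)(y)=\int k(x,y)\,d\xi(x)$; it satisfies $\langle\mu_k(\xi_1),\mu_k(\xi_2)\rangle_{\mathbb{H}_k}=\iint k\,d\xi_1\,d\xi_2$. A kernel is $c_0$ if it vanishes at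 infinity, i.e. $\{x:|k(x,y)|\ge\varepsilon\}$ is compact for all $\varepsilon>0$, $y\in\mathbb{X}$. A $c_0$-kernel is $c_0$-universal if $\mu_k$ is injective on $\mathcal{M}_b(\mathbb{X})$ (equivalently, $\mathbb{H}_k$ is dense in $C_0(\mathbb{X})$ for the uniform norm). A random probability $\tilde P$ is a random element of $\mathcal{P}(\mathbb{X})$; its mean measure $\mathbb{E}[\tilde P]$ is the probability measure with $\int f\,d\mathbb{E}[\tilde P]=\mathbb{E}[\int f\,d\tilde P]$ for all bounded measurable $f$. A point $z\in\mathbb{X}$ is a fixed atom of $\tilde P$ if $\mathbb{P}(\tilde P(\{z\})>0)>0$. The kernel covariance is $\mathrm{Cov}_k(\tilde P_1,\tilde P_2)=\mathbb{E}\big[\langle\mu_k(\tilde P_1)-\mathbb{E}[\mu_k(\tilde P_1)],\mu_k(\tilde P_2)-\mathbb{E}[\mu_k(\tilde P_2)]\rangle_{\mathbb{H}_k}\big]$, where the expectation of an $\mathbb{H}_k$-valued random element $V$ is characterised by $\langle h,\mathbb{E}[V]\rangle=\mathbb{E}\langle h,V\rangle$ for all $h\in\mathbb{H}_k$. $\mathrm{Var}_k(\tilde P)=\mathrm{Cov}_k(\tilde P,\tilde P)$, and when both kernel variances are positive, $\mathrm{Corr}_k(\tilde P_1,\tilde P_2)=\mathrm{Cov}_k(\tilde P_1,\tilde P_2)/\big(\sqrt{\mathrm{Var}_k(\tilde P_1)}\sqrt{\mathrm{Var}_k(\tilde P_2)}\big)$. *)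

(* Defs.v *)
From HB Require Import structures.
From mathcomp Require Export all_boot all_order all_algebra.
From mathcomp Require Export all_classical all_reals all_analysis.
Set Implicit Arguments.
Unset Strict Implicit.
Unset Printing Implicit Defensive.
Import Order.TTheory GRing.Theory Num.Def Num.Theory.
Import numFieldNormedType.Exports.
Local Open Scope classical_set_scope.
Local Open Scope ring_scope.

Section space.
Context (R : realType).

Definition is_metric (X : Type) (d : X -> X -> R) : Prop :=
  [/\ forall x y, d x y = 0 <-> x = y,
      forall x y, d x y = d y x &
      forall x y z, d x z <= d x y + d y z].

Definition metrizes (X : topologicalType) (d : X -> X -> R) : Prop :=
  forall (x : X) (A : set X),
    nbhs x A <-> exists2 e : R, 0 < e & [set y | d x y < e] `<=` A.

Definition complete_metric (X : topologicalType) (d : X -> X -> R) : Prop :=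
  forall u : nat -> X,
    (forall e : R, 0 < e -> exists N, forall m n,
       (N <= m)%N -> (N <= n)%N -> d (u m) (u n) < e) ->
    exists l : X, u @ \oo --> l.

Definition polish (X : topologicalType) : Prop :=
  (exists2 D : set X, countable D & dense D) /\
  (exists d : X -> X -> R,
     [/\ is_metric d, metrizes d & complete_metric d]).

End space.

Notation borel X := (g_sigma_algebraType (@open X)).

Section signed_integral.
Context d (T : measurableType d) (R : realType).

(* The Jordan decomposition does not depend on the chosen Hahn
   decomposition, which is only unique up to null sets. *)
Definition charge_integral (nu : {charge set T -> \bar R}) (f : T -> R) : R :=
  let: exist P exN := cid (Hahn_decomposition nu) in
  let: exist N nuPN := cid exN in
  \int[jordan_pos nuPN]_x f x - \int[jordan_neg nuPN]_x f x.

Lemma charge_integral_measure (mu : {finite_measure set T -> \bar R})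
    (f : T -> R) :
  charge_integral (charge_of_finite_measure mu) f = \int[mu]_x f x.
Proof.
rewrite /charge_integral; case: cid => P exN; case: cid => N nuPN.
have [[mP _] [mN negN] PNT PN0] := nuPN.
have muN A : measurable A -> mu (A `&` N) = 0%E.
  move=> mA; apply/eqP; rewrite eq_le measure_ge0 andbT.
  by apply: negN; [exact: measurableI|exact: subIsetr].
have -> : \int[jordan_neg nuPN]_x f x = 0.
  rewrite /Rintegral (@eq_measure_integral _ _ _ _ mzero) ?integral_measure_zero//.
  move=> A mA _; transitivity (jordan_neg nuPN A) => //; rewrite jordan_negE cjordan_negE /crestr0 mem_set// /crestr.
  by transitivity (- mu (A `&` N))%E => //; rewrite muN// oppe0.
rewrite subr0 /Rintegral; congr fine; apply: eq_measure_integral => A mA _.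
transitivity (jordan_pos nuPN A) => //; rewrite jordan_posE cjordan_posE /crestr0 mem_set// /crestr.
transitivity (mu (A `&` P)) => //; rewrite -[in RHS](setIT A) -PNT setIUr measureU//.
- by rewrite -[LHS]adde0; congr (_ + _)%E; exact/esym/muN.
- exact: measurableI.
- exact: measurableI.
- by rewrite setIACA PN0 setI0.
Qed.

(* Equality of set functions is only meaningful on measurable sets: the values
   of a measure elsewhere are unconstrained. *)
Definition eq_on_measurable (nu1 nu2 : set T -> \bar R) : Prop :=
  forall A, measurable A -> nu1 A = nu2 A.

End signed_integral.

Section kernels.
Context (R : realType) (X : ptopologicalType).
Implicit Type k : X -> X -> R.

Definition is_kernel k : Prop :=
  [/\ measurable_fun [set: borel X * borel X] (fun z => k z.1 z.2),
      exists M : R, forall x y, `|k x y| <= M,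
      forall x y, k x y = k y x &
      forall (m : nat) (x : 'I_m -> X) (a : 'I_m -> R),
        0 <= \sum_i \sum_j a i * a j * k (x i) (x j)].

Definition kernel_mean k (xi : {charge set (borel X) -> \bar R}) : X -> R :=
  fun y => charge_integral xi (fun x : borel X => k x y).

Definition c0_kernel k : Prop :=
  is_kernel k /\
  forall (y : X) (e : R), 0 < e -> compact [set x | e <= `|k x y|].

Definition c0_universal k : Prop :=
  c0_kernel k /\
  forall xi1 xi2 : {charge set (borel X) -> \bar R},
    kernel_mean k xi1 = kernel_mean k xi2 -> eq_on_measurable xi1 xi2.

End kernels.

(* A realisation of the reproducing kernel Hilbert space of k: a Hilbert space
   whose vectors h are identified with functions rkhs_fun h on X. By the
   Moore-Aronszajn theorem such a realisation exists for every kernel k, and it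
   is unique up to the isometry that preserves the underlying functions. *)
Record rkhs (R : realType) (X : Type) (k : X -> X -> R) := Rkhs {
  rkhs_space :> completeNormedModType R;
  rkhs_dot : {dot rkhs_space for idfun};
  rkhs_normE : forall h : rkhs_space, `|h| = Num.sqrt (rkhs_dot h h);
  rkhs_fun : {linear rkhs_space -> (X -> R^o)};
  rkhs_fun_inj : injective rkhs_fun;
  rkhs_reproducing : forall x : X,
    exists2 kx : rkhs_space, rkhs_fun kx = k ^~ x
      & forall h : rkhs_space, rkhs_dot h kx = rkhs_fun h x }.
Arguments rkhs_dot {R X k} H : rename.
Arguments rkhs_fun {R X k} H : rename.

Section covariance.
Context (R : realType) (X : ptopologicalType) (k : X -> X -> R) (H : rkhs k).
Context d (Omega : measurableType d) (P : probability Omega R).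

Definition mean_embedding (xi : {charge set (borel X) -> \bar R}) : H :=
  xget 0 [set h : H | rkhs_fun H h = kernel_mean k xi].

(* The expectation of an H-valued random element; the default value 0 is used
   when no such vector exists. *)
Definition rkhs_expectation (V : Omega -> H) : H :=
  xget 0 [set m : H | forall h : H,
    (rkhs_dot H h m)%:E = 'E_P[fun w => rkhs_dot H h (V w)]%E].

(* pprobability (borel X) R is the type of probability measures with the
   sigma-algebra generated by the evaluation maps. *)
Definition random_embedding (Pt : Omega -> pprobability (borel X) R)
    (w : Omega) : H :=
  mean_embedding (charge_of_finite_measure (Pt w)).

Definition kernel_cov (Pt1 Pt2 : Omega -> pprobability (borel X) R) : R :=
  let V1 := random_embedding Pt1 in
  let V2 := random_embedding Pt2 in
  fine ('E_P[fun w => rkhs_dot H (V1 w - rkhs_expectation V1)%R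
                                 (V2 w - rkhs_expectation V2)%R])%E.

Definition kernel_var (Pt : Omega -> pprobability (borel X) R) : R :=
  kernel_cov Pt Pt.

(* Since x / 0 = 0, the value is 0 if one of the kernel variances vanishes. *)
Definition kernel_corr (Pt1 Pt2 : Omega -> pprobability (borel X) R) : R :=
  kernel_cov Pt1 Pt2 /
    (Num.sqrt (kernel_var Pt1) * Num.sqrt (kernel_var Pt2)).

Definition discrete_measure (mu : set (borel X) -> \bar R) : Prop :=
  exists2 D : set (borel X), countable D & mu (~` D) = 0%E.

Definition as_discrete (Pt : Omega -> pprobability (borel X) R) : Prop :=
  {ae P, forall w, discrete_measure (Pt w)}.

Definition fixed_atom (Pt : Omega -> pprobability (borel X) R) (z : X) : Prop :=
  (0 < P [set w | 0 < Pt w [set z]])%E.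

End covariance.

(* Main.v *)
From HB Require Import structures.
Require Import Defs.
From mathcomp Require Import measurable_realfun ring.
Set Implicit Arguments.
Unset Strict Implicit.
Unset Printing Implicit Defensive.
Import Order.TTheory GRing.Theory Num.Def Num.Theory.
Import numFieldNormedType.Exports.
Import HBNNSimple.
Local Open Scope classical_set_scope.
Local Open Scope ring_scope.

(** Correlation 1 is equality in the Cauchy-Schwarz inequality for
    H-valued square-integrable random elements, so the centred embeddings are
    almost surely proportional: s2 (V1 - m1) = s1 (V2 - m2) with s1, s2 > 0.
    Hence s2 V1 - s1 V2 is almost surely constant, and by injectivity of the
    embedding so is the signed measure s2 Pt1 - s1 Pt2. A positive value of this
    measure at a point z would bound Pt1 {z} away from 0 almost surely, and a
    negative value would do the same for Pt2 {z}; both are excluded by the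
    assumption on fixed atoms. Being discrete and atomless, the measure
    vanishes, and total masses give s1 = s2. The same argument shows that the kernel
    variances are positive: otherwise Pt_i would be almost surely a fixed
    discrete measure, hence have an atom of constant mass.

    Discreteness gives the embedding of Pt_i as the norm-convergent series
    of mass(z) k(., z) over atoms z, so that no representation theorem is
    needed. *)

(** * Integrals of almost everywhere equal functions *)

Section integral_ae.
Context d (T : measurableType d) (R : realType).
Variable mu : {measure set T -> \bar R}.
Local Open Scope ereal_scope.

(** A simple function below [f], cut off to 0 on a measurable null set outside which [f] and [g]
    agree, lies below [g] and keeps its integral. *)
Lemma ge0_ae_le_integral (f g : T -> \bar R) :
  (forall x, 0 <= f x) -> (forall x, 0 <= g x) ->
  {ae mu, forall x, f x = g x} -> \int[mu]_x f x <= \int[mu]_x g x.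
Proof.
move=> f0 g0 [N [mN N0 fgN]]; rewrite !ge0_integralTE//.
apply: ge_ereal_sup => _ [h /= hf <-].
have mNC : measurable (~` N) by exact: measurableC.
have -> : sintegral mu h = sintegral mu (proj_nnsfun h mNC).
  rewrite -!integralT_nnsfun; apply: ge0_ae_eq_integral => //.
  - exact/measurable_EFinP.
  - exact/measurable_EFinP.
  - by move=> x _; rewrite lee_fin.
  - by move=> x _; rewrite lee_fin.
  - exists N; split => // x; apply: contra_notP => xN _ /=.
    by rewrite /mindic indicE mem_set ?mulr1.
apply: ereal_sup_ubound; exists (proj_nnsfun h mNC) => //= x.
rewrite /mindic indicE; have [/set_mem xN|xN] := boolP (x \in ~` N).
  rewrite mulr1; suff <- : f x = g x by [].
  by apply: contra_notP xN => /fgN.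
by rewrite mulr0.
Qed.

(* No measurability is required: the integral of a nonnegative function is the
   supremum of the integrals of the simple functions below it. *)
Lemma ae_eq_integralT (f g : T -> \bar R) :
  {ae mu, forall x, f x = g x} -> \int[mu]_x f x = \int[mu]_x g x.
Proof.
move=> fg; rewrite integralE [RHS]integralE.
by congr (_ - _); apply/eqP; rewrite eq_le; apply/andP; split;
  apply: ge0_ae_le_integral => //; apply: filterS fg => x;
  by rewrite !(funeposE, funenegE) => ->.
Qed.

End integral_ae.

(** * Integrals of bounded functions against probability measures and kernels *)

Section bounded.
Context d (T : measurableType d) (R : realType).
Implicit Type P : probability T R.

Lemma Rintegral_cst_probability P (c : R) : \int[P]_x c = c.
Proof.
rewrite Rintegral_cst//; have /(congr1 (@fine R)) /= P1 := probability_setT P.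
by rewrite [X in _ * X]P1 mulr1.
Qed.

Lemma bounded_integrableT (mu : {finite_measure set T -> \bar R}) (f : T -> R)
    (C : R) :
  measurable_fun setT f -> (forall x, `|f x| <= C) ->
  mu.-integrable setT (EFin \o f).
Proof.
move=> mf fC; apply: measurable_bounded_integrable => //.
  by rewrite -ge0_fin_numE// fin_num_measure.
exists C; split; first exact: num_real.
by move=> M CM x _ /=; exact: le_trans (fC x) (ltW CM).
Qed.

Lemma le_normr_Rintegral_bounded P (f : T -> R) (C : R) :
  measurable_fun setT f -> (forall x, `|f x| <= C) ->
  `|\int[P]_x f x| <= C.
Proof.
move=> mf fC; have fi := bounded_integrableT P mf fC.
apply: le_trans (le_normr_Rintegral measurableT fi) _.
have -> : C = \int[P]_x (fun=> C) x.
  by rewrite Rintegral_cst_probability.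
apply: le_Rintegral => //.
- apply: (@bounded_integrableT P _ C); first exact: measurableT_comp.
  by move=> x; rewrite normr_id.
- by apply: (@bounded_integrableT P _ `|C|).
Qed.

End bounded.

(** Adding [C] makes the integrand nonnegative, where measurability of integrals against a kernel is
    known; since each [kap x] has mass 1, exactly [C] is subtracted afterwards. *)
Lemma measurable_Rintegral_kernel d1 d2 (T1 : measurableType d1)
    (T2 : measurableType d2) (R : realType) (kap : T1 -> pprobability T2 R)
    (f : T1 * T2 -> R) (C : R) :
  measurable_fun setT kap -> measurable_fun setT f ->
  (forall z, `|f z| <= C) ->
  measurable_fun setT (fun x => \int[kap x]_y f (x, y)).
Proof.
move=> mkap mf fC.
have mfx x : measurable_fun setT (fun y => f (x, y)).
  exact: measurable_fun_pair2.
rewrite (_ : (fun x => _) = (fun x =>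
    fine (\int[kprobability mkap x]_y (f (x, y) + C)%:E)%E - C)); last first.
  apply/funext => x; rewrite -[X in _ = X - _]/(\int[kap x]_y (f (x, y) + C)).
  rewrite RintegralD//.
  - by rewrite Rintegral_cst_probability addrK.
  - exact: bounded_integrableT (mfx x) (fun y => fC (x, y)).
  - exact: (@bounded_integrableT _ _ _ _ _ `|C|).
apply: measurable_funB => //; apply: measurableT_comp => //.
apply: (@measurable_fun_integral_sfinite_kernel _ _ T1 T2 R
  (fun z => (f z + C)%:E) (kprobability mkap)).
  move=> z; rewrite lee_fin -lerBlDr sub0r.
  by have := fC z; rewrite ler_norml => /andP[].
by apply/measurable_EFinP; exact: measurable_funD.
Qed.

(** Total mass 1 makes the almost-everywhere filter proper. This supplies the reference outcome [w0]
    in the proof that variances are positive. *)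
Lemma ae_ex d (T : measurableType d) (R : realType) (P : probability T R)
    (Q : T -> Prop) : {ae P, forall w, Q w} -> exists w, Q w.
Proof.
have PF : ProperFilter (almost_everywhere P).
  apply: ae_properfilter_algebraOfSetsType.
  by rewrite [X in (_ < X)%E](probability_setT P).
exact: filter_ex.
Qed.

(** * Functions almost everywhere equal to bounded measurable ones *)

Section ae_bounded.
Context d (T : measurableType d) (R : realType) (P : probability T R).

(** Embeddings are controlled only at outcomes where the random measure is discrete, so their inner
    products are known to be bounded and measurable only up to a null set. *)
Definition ae_bounded_measurable (f : T -> R) := exists g : T -> R,
  [/\ measurable_fun setT g, exists C : R, forall w, `|g w| <= C
    & {ae P, forall w, f w = g w}].

Lemma ae_bounded_cst c : ae_bounded_measurable (fun=> c).
Proof.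
by exists (fun=> c); split; [by []|exists `|c|; by []|exact: nearW].
Qed.

Lemma ae_boundedD f g : ae_bounded_measurable f -> ae_bounded_measurable g ->
  ae_bounded_measurable (fun w => f w + g w).
Proof.
move=> [f' [mf [C fC] ff]] [g' [mg [D gD] gg]].
exists (fun w => f' w + g' w); split.
- exact: measurable_funD.
- by exists (C + D) => w; apply: le_trans (ler_normD _ _) (lerD _ _).
- by apply: filterS2 ff gg => w -> ->.
Qed.

Lemma ae_boundedZ c f : ae_bounded_measurable f ->
  ae_bounded_measurable (fun w => c * f w).
Proof.
move=> [f' [mf [C fC] ff]]; exists (fun w => c * f' w); split.
- exact: measurable_funM.
- by exists (`|c| * C) => w; rewrite normrM ler_wpM2l.
- by apply: filterS ff => w ->.
Qed.

Lemma ae_bounded_expectation f : ae_bounded_measurable f ->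
  'E_P[f]%E = (\int[P]_w f w)%:E.
Proof.
move=> [g [mg [C gC] fg]]; rewrite unlock /Rintegral fineK//.
rewrite (@ae_eq_integralT _ _ _ P _ (EFin \o g)).
  exact: integrable_fin_num (bounded_integrableT P mg gC).
by apply: filterS fg => w ->.
Qed.

Lemma ae_eq_Rintegral (f g : T -> R) : {ae P, forall w, f w = g w} ->
  \int[P]_w f w = \int[P]_w g w.
Proof.
by move=> fg; congr fine; apply: ae_eq_integralT; apply: filterS fg => w ->.
Qed.

Lemma ae_bounded_RintegralD f g :
  ae_bounded_measurable f -> ae_bounded_measurable g ->
  \int[P]_w (f w + g w) = \int[P]_w f w + \int[P]_w g w.
Proof.
move=> [f' [mf [C fC] ff]] [g' [mg [D gD] gg]].
rewrite (ae_eq_Rintegral ff) (ae_eq_Rintegral gg) -RintegralD//.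
- by apply: ae_eq_Rintegral; apply: filterS2 ff gg => w -> ->.
- exact: bounded_integrableT mf fC.
- exact: bounded_integrableT mg gD.
Qed.

Lemma ae_bounded_RintegralZ c f : ae_bounded_measurable f ->
  \int[P]_w (c * f w) = c * \int[P]_w f w.
Proof.
move=> [f' [mf [C fC] ff]]; rewrite (ae_eq_Rintegral ff) -RintegralZl//.
- by apply: ae_eq_Rintegral; apply: filterS ff => w ->.
- exact: bounded_integrableT mf fC.
Qed.

Lemma ae_bounded_Rintegral_eq0 f : ae_bounded_measurable f ->
  (forall w, 0 <= f w) -> \int[P]_w f w = 0 -> {ae P, forall w, f w = 0}.
Proof.
move=> [g [mg [C gC] fg]] f0; rewrite (ae_eq_Rintegral fg) => g0.
(* The representative [g] is nonnegative only almost everywhere, whereas the vanishing criterion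
   concerns the integral of its absolute value. *)
have gN : {ae P, forall w, g w = `|g w|}.
  by apply: filterS fg => w <-; rewrite ger0_norm.
have /(ae_eq_integral_abs P measurableT) :
    measurable_fun setT (EFin \o g) by exact/measurable_EFinP.
case=> + _ => /(_ _)/wrap[].
  rewrite -(@ae_eq_integralT _ _ _ P (EFin \o g)).
    rewrite -[LHS]fineK; first by rewrite -[fine _]/(\int[P]_w g w) g0.
    exact: integrable_fin_num (bounded_integrableT P mg gC).
  by apply: filterS gN => w /= {1}->.
by move=> gae; apply: filterS2 fg gae => w -> /(_ I)[].
Qed.

End ae_bounded.

(** * Probability measures carried by a sequence of points *)

Section atoms.
Context d (T : measurableType d) (R : realType).
Hypothesis measurable_singleton : forall t : T, measurable [set t].

(** The sequence [e] may repeat values; [seqDU] counts each point at its first occurrence and gives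
    mass 0 to the later ones. *)
Definition atom_mass (mu : set T -> \bar R) (e : nat -> T) (n : nat) : R :=
  fine (mu (seqDU (fun j => [set e j]) n)).

Lemma measurable_range (e : nat -> T) : measurable (range e).
Proof.
by rewrite -bigcup_imset1; apply: bigcup_measurable.
Qed.

Lemma measurable_seqDU_singleton (e : nat -> T) n :
  measurable (seqDU (fun j => [set e j]) n).
Proof.
by apply: measurableD => //; exact: bigsetU_measurable.
Qed.

(** The partial sums are the integrals of [h] restricted to the first [n] points, and dominated
    convergence with the constant bound [C] applies. *)
Lemma cvg_series_atoms (P : probability T R) (e : nat -> T) (h : T -> R)
    (C : R) :
  P (~` range e) = 0%E -> measurable_fun setT h -> (forall x, `|h x| <= C) ->
  series (fun n => atom_mass P e n * h (e n)) @ \oo --> \int[P]_x h x.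
Proof.
move=> Pe mh hC.
pose A := seqDU (fun j => [set e j]).
have mA n : measurable (A n) by exact: measurable_seqDU_singleton.
pose B n := \big[setU/set0]_(i <- index_iota 0 n) A i.
have BE n x : B n x = exists2 i, (i < n)%N & x = e i.
  rewrite /B big_mkord /A -(bigsetU_seqDU (fun j => [set e j])).
  rewrite -(bigcup_mkord n (fun j => [set e j])).
  by apply/propext; split=> [[i /= ni ->]|[i ni ->]]; exists i.
have mB n : measurable (B n) by exact: bigsetU_measurable.
pose f n := (EFin \o h) \_ (B n).
have mEh : measurable_fun setT (EFin \o h) by exact/measurable_EFinP.
have mf n : measurable_fun setT (f n).
  apply/(measurable_restrictT _ (mB n)).
  exact: measurable_funS mEh.
have fint n : (\int[P]_x f n x =
    (series (fun n => atom_mass P e n * h (e n)) n)%:E)%E.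
  rewrite -integral_mkcond integral_bigsetU_EFin//; last first.
  - exact: measurable_funS mEh.
  - by apply: sub_trivIset (trivIset_seqDU _).
  - exact: iota_uniq.
  rewrite /series/= -sumEFin; apply: eq_bigr => i _.
  have -> : (\int[P]_(x in A i) (h x)%:E = \int[P]_(x in A i) (h (e i))%:E)%E.
    by apply: eq_integral => x /set_mem [/= -> _].
  rewrite integral_cst// EFinM muleC; congr (_ * _)%E.
  by rewrite /atom_mass fineK// fin_num_measure.
have [|||_ _] := @dominated_convergence _ _ _ P setT measurableT f (EFin \o h)
  (fun=> C%:E) mf mEh.
- exists (~` range e); split => //.
    by apply: measurableC; exact: measurable_range.
  (* At [x = e i] the restrictions are constant from [i.+1] on, since [B n] collects the indices
     below [n]. *)
  apply: subsetC => x [i _ <-] _; apply: cvg_near_cst; exists i.+1 => // n /= ni.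
  by rewrite /f patchE mem_set//; rewrite BE; exists i.
- by apply: (@bounded_integrableT _ _ _ _ _ `|C|).
- apply: nearW => x n _; rewrite /f patchE; case: ifPn => _ /=.
    by rewrite lee_fin.
  by rewrite normr0 lee_fin (le_trans _ (hC x)).
rewrite (_ : (fun n : nat => _) =
    EFin \o series (fun n => atom_mass P e n * h (e n))); last first.
  by apply/funext => n; rewrite /= fint.
rewrite -[X in _ --> X]fineK; last first.
  exact: integrable_fin_num (bounded_integrableT P mh hC).
by move=> /fine_cvgP[].
Qed.

Lemma atom_mass_ge0 (P : probability T R) (e : nat -> T) n :
  0 <= atom_mass P e n.
Proof. exact/fine_ge0/measure_ge0. Qed.

Lemma seqDU_singleton (e : nat -> T) n :
  seqDU (fun j => [set e j]) n = [set e n] \/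
  seqDU (fun j => [set e j]) n = set0.
Proof.
have [en|en] := pselect ((\big[setU/set0]_(i < n) [set e i]) (e n)).
  by right; rewrite -subset0 => x [/= ->]; exact.
left; apply/seteqP; split => x /=; first by case.
by move=> ->; split.
Qed.

(** Expanding the integral of the indicator of [A] over the points of [e] exhibits both sides as
    limits of one and the same series. *)
Lemma eq_probability_atoms (P1 P2 : probability T R) (e : nat -> T) (a b : R) :
  P1 (~` range e) = 0%E -> P2 (~` range e) = 0%E ->
  (forall z, a * fine (P1 [set z]) = b * fine (P2 [set z])) ->
  forall A, measurable A -> a * fine (P1 A) = b * fine (P2 A).
Proof.
move=> P1e P2e ab A mA.
have cvgA (P : probability T R) c : P (~` range e) = 0%E ->
    c * series (fun n => atom_mass P e n * \1_A (e n)) n @[n --> \oo] -->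
    c * fine (P A).
  move=> Pe; have -> : fine (P A) = \int[P]_x \1_A x.
    by rewrite /Rintegral integral_indic// setIT.
  apply: cvgM; first exact: cvg_cst.
  apply: (@cvg_series_atoms _ _ _ 1) => // x.
  by rewrite indicE; case: (x \in A); rewrite ?normr1 ?normr0.
have := cvgA _ b P2e; rewrite [X in X @ \oo](_ : _ = fun n =>
    a * series (fun n => atom_mass P1 e n * \1_A (e n)) n).
  by move=> h; apply: cvg_unique h => //; exact: cvgA.
apply/funext => n; rewrite /series/= !mulr_sumr; apply: eq_bigr => i _.
rewrite !mulrA; congr (_ * _); rewrite /atom_mass.
by have [->|->] := seqDU_singleton e i; rewrite ?measure0 ?mulr0 ?ab.
Qed.

End atoms.

(** * Hilbert space geometry and mean embeddings of discrete probabilities *)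

Section rkhs.
Context (R : realType) (X : ptopologicalType) (k : X -> X -> R) (H : rkhs k).
Local Notation "''[' u , v ]" := (rkhs_dot H u v).

Lemma rkhs_dotC u v : '[u, v] = '[v, u].
Proof. by rewrite hermC/= expr0 mul1r. Qed.

Lemma rkhs_dotDl u v w : '[u + v, w] = '[u, w] + '[v, w].
Proof. exact: linearDl. Qed.

Lemma rkhs_dotDr u v w : '[u, v + w] = '[u, v] + '[u, w].
Proof. exact: linearDr. Qed.

Lemma rkhs_dotNl u v : '[- u, v] = - '[u, v].
Proof. exact: linearNl. Qed.

Lemma rkhs_dotNr u v : '[u, - v] = - '[u, v].
Proof. exact: linearNr. Qed.

Lemma rkhs_dotZl a u v : '[a *: u, v] = a * '[u, v].
Proof. exact: linearZl_LR. Qed.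

Lemma rkhs_dotZr a u v : '[u, a *: v] = a * '[u, v].
Proof. exact: linearZr_LR. Qed.

Lemma rkhs_dot0r u : '[u, 0] = 0.
Proof. exact: linear0r. Qed.

Lemma rkhs_dot_ge0 u : 0 <= '[u, u].
Proof.
by have [->|/(@neq0_dnorm_gt0 _ _ _ (rkhs_dot H) _)/ltW//] := eqVneq u 0; rewrite rkhs_dot0r.
Qed.

Lemma rkhs_dot_eq0 u : '[u, u] = 0 -> u = 0.
Proof.
move=> uu; apply/eqP; apply: contraPT uu => /(@neq0_dnorm_gt0 _ _ _ (rkhs_dot H) _).
by move=> /gt_eqF/eqP.
Qed.

Lemma rkhs_cauchy_schwarz u v : `|'[u, v]| <= `|u| * `|v|.
Proof.
rewrite !rkhs_normE -sqrtrM ?rkhs_dot_ge0// -sqrtr_sqr ler_wsqrtr//.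
have [->|v0] := eqVneq v 0; first by rewrite !rkhs_dot0r expr0n mulr0.
have vv : 0 < '[v, v] by exact: (@neq0_dnorm_gt0 _ _ _ (rkhs_dot H)).
(* The squared norm of this vector is ['[v, v]] times ['[u, u] * '[v, v] - '[u, v] ^+ 2]. *)
have := rkhs_dot_ge0 ('[v, v] *: u - '[u, v] *: v).
rewrite !(rkhs_dotDl, rkhs_dotDr, rkhs_dotNl, rkhs_dotNr, rkhs_dotZl, rkhs_dotZr).
rewrite (rkhs_dotC v u) => h.
rewrite -subr_ge0 -(pmulr_rge0 _ vv); apply: le_trans h _.
by rewrite le_eqVlt; apply/orP; left; apply/eqP; ring.
Qed.

Lemma rkhs_dot_cvg u (v : nat -> H) (l : H) : v @ \oo --> l ->
  '[u, v n] @[n --> \oo] --> '[u, l].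
Proof.
move=> vl; apply/cvgrPdist_le => e e0.
have u1 : 0 < `|u| + 1 by rewrite ltr_wpDl.
near=> n.
rewrite -rkhs_dotNr -rkhs_dotDr (le_trans (rkhs_cauchy_schwarz _ _))//.
apply: (@le_trans _ _ ((`|u| + 1) * `|l - v n|)).
  by rewrite ler_wpM2r// lerDl.
rewrite mulrC -ler_pdivlMr//; near: n.
by move/cvgrPdist_le: vl; apply; rewrite divr_gt0.
Unshelve. all: by end_near. Qed.

Lemma rkhs_dot_sumr u n (F : nat -> H) :
  '[u, \sum_(0 <= i < n) F i] = \sum_(0 <= i < n) '[u, F i].
Proof. by elim/big_rec2 : _ => [|i x y _ <-]; rewrite ?rkhs_dot0r ?rkhs_dotDr. Qed.

Section mean.
Hypothesis measurable_singleton : forall x : borel X, measurable [set x].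
Variables (M : R) (kM : forall x y, `|k x y| <= M).

Definition feature (x : X) : H :=
  s2val (cid2 (rkhs_reproducing H x)).

Lemma rkhs_fun_feature x : rkhs_fun H (feature x) = k ^~ x.
Proof. by rewrite /feature; case: cid2. Qed.

Lemma rkhs_dot_feature x h : '[h, feature x] = rkhs_fun H h x.
Proof. by rewrite /feature; case: cid2. Qed.

Lemma norm_feature x : `|feature x| <= Num.sqrt M.
Proof.
rewrite rkhs_normE ler_wsqrtr// rkhs_dot_feature rkhs_fun_feature.
exact: le_trans (ler_norm _) (kM _ _).
Qed.

Lemma rkhs_fun_bounded h x : `|rkhs_fun H h x| <= `|h| * Num.sqrt M.
Proof.
rewrite -rkhs_dot_feature (le_trans (rkhs_cauchy_schwarz _ _))//.
by rewrite ler_wpM2l// norm_feature.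
Qed.

(** The series of [atom_mass P e n *: feature (e n)] converges absolutely, and continuity of the
    inner product carries pairings with [h] to the limit. Taking [h] to be a feature vector
    identifies the function of the limit. *)
Lemma rkhs_mean_exists (P : probability (borel X) R) (e : nat -> borel X) :
  (forall y, measurable_fun setT (fun x : borel X => k x y)) ->
  P (~` range e) = 0%E ->
  exists2 v : H, rkhs_fun H v = (fun y => \int[P]_x k x y)
    & forall h : H, measurable_fun setT (rkhs_fun H h : borel X -> R) ->
        '[h, v] = \int[P]_x rkhs_fun H h x.
Proof.
move=> mk Pe.
have cvgh := cvg_series_atoms measurable_singleton Pe.
pose u n := atom_mass P e n *: feature (e n).
have : cvgn (series u).
  apply: normed_cvg; apply: (@series_le_cvg _ _
    (fun n => atom_mass P e n * Num.sqrt M)) => //.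
  - by move=> n /=; exact: normr_ge0.
  - by move=> n; rewrite mulr_ge0 ?atom_mass_ge0 ?sqrtr_ge0.
  - move=> n; rewrite /= /u normrZ ger0_norm ?atom_mass_ge0//.
    by rewrite ler_wpM2l ?atom_mass_ge0// norm_feature.
  (* Summability of the majorant is the expansion over atoms of a constant function. *)
  - by apply: cvgP; apply: (cvgh (fun=> Num.sqrt M) `|Num.sqrt M|).
move=> /cvg_ex[v uv].
have hv h : measurable_fun setT (rkhs_fun H h : borel X -> R) ->
    '[h, v] = \int[P]_x rkhs_fun H h x.
  move=> mh; have := cvgh _ _ mh (rkhs_fun_bounded h).
  apply: cvg_unique => //.
  rewrite [X in X @ \oo](_ : _ = fun n => '[h, series u n]).
    exact: rkhs_dot_cvg.
  apply/funext => n; rewrite /series/= rkhs_dot_sumr; apply: eq_bigr => i _.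
  by rewrite rkhs_dotZr rkhs_dot_feature.
exists v => //; apply/funext => y.
have fy : rkhs_fun H (feature y) = k ^~ y by exact: rkhs_fun_feature.
by rewrite -rkhs_dot_feature rkhs_dotC hv fy.
Qed.

End mean.
End rkhs.

(** * Borel singletons and countable supports *)

Section polish.
Context (R : realType) (X : ptopologicalType).

(** The complement of a point [x] is open: the ball around [y] of radius [dist y x] misses [x]. *)
Lemma polish_measurable_singleton :
  polish R X -> forall x : borel X, measurable [set x].
Proof.
move=> [_ [dist [[d0 dC dtri] dX _]]] x.
rewrite -[[set x]]setCK; apply: measurableC; apply: sub_sigma_algebra => /=.
rewrite openE => y /= yx; apply/(dX y); exists (dist y x).
  have d_ge0 : 0 <= dist y x.
    have := dtri y x y; rewrite (dC x y) (d0 y y).2// -mulr2n.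
    by rewrite pmulrn_lge0.
  by rewrite lt_neqAle d_ge0 andbT eq_sym; apply/eqP => /d0.
by move=> z /= + zx; rewrite zx ltxx.
Qed.

End polish.

Section discrete.
Context (R : realType) (X : ptopologicalType).
Hypothesis measurable_singleton : forall x : borel X, measurable [set x].

(** Only an inclusion is claimed: indices outside the image of the injection are sent to the default
    [point], which covers finite and empty [D]. *)
Lemma countable_sub_range (D : set (borel X)) :
  countable D -> exists e : nat -> borel X, D `<=` range e.
Proof.
move=> /countable_injP[f finj].
exists (fun n => xget point [set x | D x /\ f x = n]) => x Dx; exists (f x) => //.
case: xgetP => [y _ [Dy fyx]|/(_ x)]; last by case.
by apply: finj => //; rewrite inE.
Qed.

Lemma discrete_measure_range (P1 P2 : probability (borel X) R) :
  discrete_measure P1 -> discrete_measure P2 ->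
  exists e : nat -> borel X, P1 (~` range e) = 0%E /\ P2 (~` range e) = 0%E.
Proof.
move=> [D1 cD1 P10] [D2 cD2 P20].
have cD : countable (D1 `|` D2).
  by rewrite -bigcup2E; apply: bigcup_countable => // -[|[|n]] _.
have [e De] := countable_sub_range cD.
have null (Q : probability (borel X) R) (D : set (borel X)) :
    countable D -> D `<=` range e -> Q (~` D) = 0%E -> Q (~` range e) = 0%E.
  move=> ctD DE; apply: subset_measure0.
  - by apply: measurableC; exact: measurable_range.
  - by apply: measurableC; exact: countable_measurable.
  - exact: subsetC.
exists e; split.
- by apply: null cD1 _ P10 => x Dx; apply: De; left.
- by apply: null cD2 _ P20 => x Dx; apply: De; right.
Qed.

End discrete.

(** * Embeddings of random probabilities *)

Section random_embedding.
Context (R : realType) (X : ptopologicalType) (k : X -> X -> R) (H : rkhs k).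
Context d (Omega : measurableType d) (P : probability Omega R).
Hypothesis measurable_singleton : forall x : borel X, measurable [set x].
Hypothesis mk : measurable_fun [set: borel X * borel X] (fun z => k z.1 z.2).
Variables (M : R) (kM : forall x y, `|k x y| <= M).
Local Notation "''[' u , v ]" := (rkhs_dot H u v).

Let mkx y : measurable_fun setT (fun x : borel X => k x y).
Proof. exact: measurable_fun_pair1 mk. Qed.

(** Discreteness provides a vector with the required function, and injectivity of [rkhs_fun] forces
    the choice made by [xget] to be that vector. *)
Lemma random_embeddingP (Pt : Omega -> pprobability (borel X) R) w :
  discrete_measure (Pt w) ->
  rkhs_fun H (random_embedding H Pt w) = (fun y => \int[Pt w]_x k x y) /\
  forall h : H, measurable_fun setT (rkhs_fun H h : borel X -> R) ->
    '[h, random_embedding H Pt w] = \int[Pt w]_x rkhs_fun H h x.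
Proof.
move=> dPt; have [e [Pe _]] := discrete_measure_range measurable_singleton dPt dPt.
have [v vE hv] := rkhs_mean_exists H measurable_singleton kM mkx Pe.
suff -> : random_embedding H Pt w = v by [].
apply: (@rkhs_fun_inj _ _ _ H); rewrite /random_embedding /mean_embedding.
have kmE : kernel_mean k (charge_of_finite_measure (Pt w)) =
    (fun y => \int[Pt w]_x k x y).
  by apply/funext => y; exact: charge_integral_measure.
by case: xgetP => [h _ ->|/(_ v)]; rewrite /= ?kmE vE.
Qed.

(** Joint measurability is what iterated integrals require; [Pt \o fst] is taken as a kernel from
    the product so that the second coordinate remains a parameter of the integrand. *)
Lemma measurable_mean (Pt : Omega -> pprobability (borel X) R) :
  measurable_fun setT Pt ->
  measurable_fun [set: Omega * borel X]
    (fun z => \int[Pt z.1]_x k x z.2).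
Proof.
move=> mPt.
apply: (@measurable_Rintegral_kernel _ _ (Omega * borel X)%type (borel X) R
  (Pt \o fst) (fun z => k z.2 z.1.2) M) => //.
  exact: measurableT_comp.
have mp : measurable_fun [set: (Omega * borel X) * borel X]
    (fun z => (z.2, z.1.2)).
  by apply: measurable_fun_pair => //; exact: measurableT_comp.
exact: (measurableT_comp mk mp).
Qed.

Variables (Pt : Omega -> pprobability (borel X) R).
Hypotheses (mPt : measurable_fun setT Pt) (dPt : as_discrete P Pt).
Local Notation V := (random_embedding H Pt).

Lemma ae_bounded_dot_embedding (h : H) :
  measurable_fun setT (rkhs_fun H h : borel X -> R) ->
  ae_bounded_measurable P (fun w => '[h, V w]).
Proof.
move=> mh; exists (fun w => \int[Pt w]_x rkhs_fun H h x); split.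
- apply: (@measurable_Rintegral_kernel _ _ Omega (borel X) R Pt
    (fun z => rkhs_fun H h z.2) (`|h| * Num.sqrt M)) => //.
    exact: (measurableT_comp mh).
  by move=> z; exact: rkhs_fun_bounded.
- exists (`|h| * Num.sqrt M) => w; apply: le_normr_Rintegral_bounded => // x.
  exact: rkhs_fun_bounded.
- by apply: filterS dPt => w /random_embeddingP[_ ->].
Qed.

Lemma ae_bounded_feature_embedding x :
  {ae P, forall w, '[feature H x, V w] = \int[Pt w]_y k y x}.
Proof.
apply: filterS dPt => w /random_embeddingP[Vw _].
by rewrite rkhs_dotC rkhs_dot_feature Vw.
Qed.

Lemma mean_le_bound w x : `|\int[Pt w]_y k y x| <= M.
Proof. by apply: le_normr_Rintegral_bounded. Qed.

(* The default value 0 satisfies the claim too, so the existence of the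
   expectation is never needed. *)
Lemma measurable_rkhs_expectation :
  measurable_fun setT
    (rkhs_fun H (rkhs_expectation P V) : borel X -> R).
Proof.
rewrite /rkhs_expectation; case: xgetP => [m _ /= mE|_]; last first.
  by rewrite linear0; exact: (@measurable_cst _ _ _ _ setT (0 : R)).
rewrite (_ : rkhs_fun H m =
    (fun x => \int[P]_w \int[Pt w]_y k y x)); last first.
  apply/funext => x; rewrite -rkhs_dot_feature rkhs_dotC.
  apply: EFin_inj; rewrite mE ae_bounded_expectation.
    congr EFin; apply: ae_eq_Rintegral; exact: ae_bounded_feature_embedding.
  exists (fun w => \int[Pt w]_y k y x); split.
  - exact: measurable_fun_pair1 (measurable_mean mPt).
  - by exists M => w; exact: mean_le_bound.
  - exact: ae_bounded_feature_embedding.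
(* The constant [P] acts here as a kernel from [borel X] to [Omega]. *)
apply: (@measurable_Rintegral_kernel _ _ (borel X) Omega R (fun=> P)
  (fun z => \int[Pt z.2]_y k y z.1) M) => //.
  have ms : measurable_fun [set: borel X * Omega] (fun z => (z.2, z.1)).
    exact: measurable_fun_pair.
  exact: (measurableT_comp (measurable_mean mPt) ms).
by move=> z; exact: mean_le_bound.
Qed.

End random_embedding.

(** * Nonnegative combinations of measures and injectivity of the embedding *)

Lemma Rintegral_mscale d (T : measurableType d) (R : realType)
    (mu : {finite_measure set T -> \bar R}) (a : {nonneg R}) (f : T -> R)
    (C : R) :
  measurable_fun setT f -> (forall x, `|f x| <= C) ->
  \int[mscale a mu]_x f x = a%:num * \int[mu]_x f x.
Proof.
move=> mf fC; have fi := bounded_integrableT mu mf fC.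
have mEf : measurable_fun setT (EFin \o f) by exact/measurable_EFinP.
rewrite /Rintegral integralE !ge0_integral_mscale//; last 2 first.
- exact: measurable_funeneg.
- exact: measurable_funepos.
rewrite -muleBr//; last exact: integrable_add_def.
by rewrite -integralE fineM//; exact: integrable_fin_num.
Qed.

(* Moving negative terms to the other side keeps every measure positive, which
   avoids Jordan decompositions when injectivity of the embedding is used. *)
Section combination.
Context d (T : measurableType d) (R : realType).
Variables (P1 P2 : probability T R) (a b : {nonneg R}).

Definition combination : set T -> \bar R :=
  measure_add (mscale a P1) (mscale b P2).

HB.instance Definition _ := Measure.copy combination
  (measure_add (mscale a P1) (mscale b P2)).

Let fin_num_combination : fin_num_fun combination.
Proof.
move=> A mA; rewrite /combination measure_addE.
by rewrite fin_numD; apply/andP; split; exact: fin_num_measure.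
Qed.

HB.instance Definition _ :=
  Measure_isFinite.Build d T R combination fin_num_combination.

Lemma fine_combination A : measurable A ->
  fine (combination A) = a%:num * fine (P1 A) + b%:num * fine (P2 A).
Proof.
move=> mA; rewrite /combination measure_addE fineD ?fin_num_measure//.
by rewrite /mscale !fineM// fin_num_measure.
Qed.

Lemma Rintegral_combination (f : T -> R) (C : R) :
  measurable_fun setT f -> (forall x, `|f x| <= C) ->
  \int[combination]_x f x =
  a%:num * \int[P1]_x f x + b%:num * \int[P2]_x f x.
Proof.
move=> mf fC.
have i1 := bounded_integrableT (mscale a P1) mf fC.
have i2 := bounded_integrableT (mscale b P2) mf fC.
transitivity (\int[measure_add (mscale a P1) (mscale b P2)]_x f x) => //.
rewrite -!(Rintegral_mscale _ _ mf fC) /Rintegral integral_measure_add//.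
by rewrite fineD//; exact: integrable_fin_num.
Qed.

End combination.

Section universal.
Context (R : realType) (X : ptopologicalType) (k : X -> X -> R).
Hypothesis k_univ : c0_universal k.

Lemma universal_combination (P1 P2 Q1 Q2 : probability (borel X) R)
    (a b : {nonneg R}) :
  (forall y, a%:num * \int[P1]_x k x y + b%:num * \int[P2]_x k x y =
             a%:num * \int[Q1]_x k x y + b%:num * \int[Q2]_x k x y) ->
  forall A : set (borel X), measurable A ->
    a%:num * fine (P1 A) + b%:num * fine (P2 A) =
    a%:num * fine (Q1 A) + b%:num * fine (Q2 A).
Proof.
move=> PQ A mA; have [[[mk [M kM] _ _] _] inj] := k_univ.
rewrite -!fine_combination//; congr fine.
apply: (inj (charge_of_finite_measure (combination P1 P2 a b))
  (charge_of_finite_measure (combination Q1 Q2 a b))) => //.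
apply/funext => y; rewrite /kernel_mean !charge_integral_measure.
have mky : measurable_fun setT (fun x : borel X => k x y).
  exact: measurable_fun_pair1 mk.
by rewrite !(Rintegral_combination _ _ _ _ mky (fun x => kM x y)).
Qed.

End universal.

(** * Consequences of the hypothesis on fixed atoms *)

Section no_lower_bound.
Context (R : realType) (X : ptopologicalType).
Context d (Omega : measurableType d) (P : probability Omega R).
Hypothesis measurable_singleton : forall x : borel X, measurable [set x].
Variable Pt : Omega -> pprobability (borel X) R.
Hypothesis mPt : measurable_fun setT Pt.
Hypothesis Pt_atoms : forall z : X, fixed_atom P Pt z ->
  forall e : R, 0 < e -> (0 < P [set w | Pt w [set z] < e%:E])%E.

(** Such a bound would make [z] a fixed atom, and the hypothesis would then give positive
    probability to a mass below [e]. *)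
Lemma atom_no_lower_bound z (e : R) :
  0 < e -> ~ {ae P, forall w, (e%:E <= Pt w [set z])%E}.
Proof.
move=> e0 Pte.
have mz : measurable_fun setT (fun w => Pt w [set z]).
  exact: (measurable_kernel (kprobability mPt) _ (measurable_singleton z)).
have null (c : R) : c <= e -> P [set w | Pt w [set z] < c%:E]%E = 0%E.
  move=> ce; apply: measure_negligible.
    rewrite -[X in measurable X]setTI; exact: emeasurable_fun_infty_o.
  apply: negligibleS Pte => w /= wc; apply/negP; rewrite -ltNge.
  by apply: lt_le_trans wc _; rewrite lee_fin.
suff : fixed_atom P Pt z by move=> /Pt_atoms/(_ e e0); rewrite null// ltxx.
(* Were [z] not a fixed atom, the event of zero mass at [z] would have probability 1, yet the lower
   bound makes it null. *)
rewrite /fixed_atom lt0e measure_ge0 andbT; apply/eqP => P0.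
have mpos : measurable [set w | 0 < Pt w [set z]]%E.
  by rewrite -[X in measurable X]setTI; exact: emeasurable_fun_o_infty.
have := probability_setC P mpos; rewrite P0 sube0 => P1.
have : P (~` [set w | 0 < Pt w [set z]]%E) = 0%E.
  apply: measure_negligible; first exact: measurableC.
  apply: negligibleS Pte => w /= wz; apply/negP; rewrite -ltNge.
  by move/negP: wz; rewrite -leNgt => /le_lt_trans; apply; rewrite lte_fin.
by rewrite P1 => /eqP; rewrite onee_eq0.
Qed.

Lemma atom_difference_le (Qt : Omega -> pprobability (borel X) R) z
    (a b c1 c2 : R) :
  0 < a -> 0 <= b ->
  {ae P, forall w, a * fine (Pt w [set z]) + c2 =
                   c1 + b * fine (Qt w [set z])} ->
  c1 <= c2.
Proof.
move=> a0 b0 PQ; rewrite leNgt; apply/negP => c12.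
(* Dropping the nonnegative term in [Qt] leaves this number as an almost sure lower bound for the
   mass of [z] under [Pt]. *)
have e0 : 0 < (c1 - c2) / a by rewrite divr_gt0// subr_gt0.
apply: (@atom_no_lower_bound z _ e0); apply: filterS PQ => w PQw.
rewrite -[leRHS]fineK ?fin_num_measure// lee_fin ler_pdivrMr// mulrC.
rewrite lerBlDr PQw lerDl mulr_ge0//; exact/fine_ge0/measure_ge0.
Qed.

End no_lower_bound.

(** * The equality case of the Cauchy-Schwarz inequality in expectation *)

Section cauchy_schwarz_equality.
Context (R : realType) (X : ptopologicalType) (k : X -> X -> R) (H : rkhs k).
Context d (Omega : measurableType d) (P : probability Omega R).
Local Notation "''[' u , v ]" := (rkhs_dot H u v).

(** The expected squared norm of [s2 *: U1 - s1 *: U2] is [s2 ^+ 2 * s1 ^+ 2 - 2 * (s1 * s2) ^+ 2 +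
    s1 ^+ 2 * s2 ^+ 2], that is 0. *)
Lemma rkhs_expectation_cauchy_schwarz_eq (U1 U2 : Omega -> H) :
  ae_bounded_measurable P (fun w => '[U1 w, U1 w]) ->
  ae_bounded_measurable P (fun w => '[U1 w, U2 w]) ->
  ae_bounded_measurable P (fun w => '[U2 w, U2 w]) ->
  \int[P]_w '[U1 w, U2 w] = Num.sqrt (\int[P]_w '[U1 w, U1 w]) *
                            Num.sqrt (\int[P]_w '[U2 w, U2 w]) ->
  {ae P, forall w, Num.sqrt (\int[P]_w '[U2 w, U2 w]) *: U1 w =
                   Num.sqrt (\int[P]_w '[U1 w, U1 w]) *: U2 w}.
Proof.
move=> b11 b12 b22.
set s1 := Num.sqrt (\int[P]_w '[U1 w, U1 w]).
set s2 := Num.sqrt (\int[P]_w '[U2 w, U2 w]) => e12.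
have s1E : s1 ^+ 2 = \int[P]_w '[U1 w, U1 w].
  by rewrite sqr_sqrtr// Rintegral_ge0// => w _; exact: rkhs_dot_ge0.
have s2E : s2 ^+ 2 = \int[P]_w '[U2 w, U2 w].
  by rewrite sqr_sqrtr// Rintegral_ge0// => w _; exact: rkhs_dot_ge0.
pose D w := s2 *: U1 w - s1 *: U2 w.
have DE : (fun w => '[D w, D w]) = (fun w => s2 ^+ 2 * '[U1 w, U1 w] +
    (- (s1 * s2 *+ 2) * '[U1 w, U2 w] + s1 ^+ 2 * '[U2 w, U2 w])).
  apply/funext => w; rewrite /D.
  rewrite !(rkhs_dotDl, rkhs_dotDr, rkhs_dotNl, rkhs_dotNr, rkhs_dotZl, rkhs_dotZr).
  by rewrite (rkhs_dotC (U2 w) (U1 w)); ring.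
have bD : ae_bounded_measurable P (fun w => '[D w, D w]).
  by rewrite DE; do 2?apply: ae_boundedD; exact: ae_boundedZ.
have : \int[P]_w '[D w, D w] = 0.
  rewrite [X in Rintegral _ _ X]DE.
  rewrite ae_bounded_RintegralD; [|exact: ae_boundedZ|
    by apply: ae_boundedD; exact: ae_boundedZ].
  rewrite ae_bounded_RintegralD; [|exact: ae_boundedZ|exact: ae_boundedZ].
  by rewrite !ae_bounded_RintegralZ// e12 -s1E -s2E; ring.
move=> /(ae_bounded_Rintegral_eq0 bD (fun w => rkhs_dot_ge0 _)).
by apply: filterS => w /rkhs_dot_eq0/eqP; rewrite subr_eq0 => /eqP.
Qed.

End cauchy_schwarz_equality.

(** * Kernel covariances as integrals of bounded functions *)

Section covariance.
Context (R : realType) (X : ptopologicalType) (k : X -> X -> R) (H : rkhs k).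
Context d (Omega : measurableType d) (P : probability Omega R).
Hypothesis measurable_singleton : forall x : borel X, measurable [set x].
Hypothesis k_univ : c0_universal k.
Local Notation "''[' u , v ]" := (rkhs_dot H u v).

Let mk : measurable_fun [set: borel X * borel X] (fun z => k z.1 z.2).
Proof. by have [[[]]] := k_univ. Qed.

Let bounded_kernel : exists M : R, forall x y, `|k x y| <= M.
Proof. by have [[[]]] := k_univ. Qed.

Definition centered (Pt : Omega -> pprobability (borel X) R) (w : Omega) : H :=
  random_embedding H Pt w - rkhs_expectation P (random_embedding H Pt).

(** Bilinearity leaves pairings with the expectations, whose functions are measurable, and the
    pairing of the two embeddings. *)
Lemma ae_bounded_dot_centered (Pt1 Pt2 : Omega -> pprobability (borel X) R) :
  measurable_fun setT Pt1 -> measurable_fun setT Pt2 ->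
  as_discrete P Pt1 -> as_discrete P Pt2 ->
  ae_bounded_measurable P (fun w => '[centered Pt1 w, centered Pt2 w]).
Proof.
move=> mPt1 mPt2 dPt1 dPt2; have [M kM] := bounded_kernel.
rewrite /centered; set V1 := random_embedding H Pt1.
set V2 := random_embedding H Pt2.
set m1 := rkhs_expectation P V1; set m2 := rkhs_expectation P V2.
have mm1 : measurable_fun setT (rkhs_fun H m1 : borel X -> R).
  exact: measurable_rkhs_expectation kM _ mPt1 dPt1.
have mm2 : measurable_fun setT (rkhs_fun H m2 : borel X -> R).
  exact: measurable_rkhs_expectation kM _ mPt2 dPt2.
rewrite (_ : (fun w => _) = (fun w => '[V1 w, V2 w] +
    (-1 * '[m1, V2 w] + (-1 * '[m2, V1 w] + '[m1, m2])))); last first.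
  apply/funext => w; rewrite !(rkhs_dotDl, rkhs_dotDr, rkhs_dotNl, rkhs_dotNr).
  by rewrite (rkhs_dotC (V1 w) m2); ring.
apply: ae_boundedD; last first.
  apply: ae_boundedD; last apply: ae_boundedD; last exact: ae_bounded_cst.
    by apply: ae_boundedZ; exact: ae_bounded_dot_embedding kM _ mPt2 dPt2 _ mm1.
  by apply: ae_boundedZ; exact: ae_bounded_dot_embedding kM _ mPt1 dPt1 _ mm2.
have mV w : measurable_fun setT (fun y : borel X => \int[Pt1 w]_x k x y).
  exact: measurable_fun_pair2 (measurable_mean mk kM mPt1).
(* For each [w] the vector [V1 w] itself serves as [h] in [random_embeddingP], so the pairing
   becomes an iterated integral of [k]. *)
exists (fun w => \int[Pt2 w]_y \int[Pt1 w]_x k x y); split.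
- apply: (@measurable_Rintegral_kernel _ _ Omega (borel X) R Pt2
    (fun z => \int[Pt1 z.1]_x k x z.2) M) => //.
    by have := measurable_mean mk kM mPt1.
  by move=> z; exact: mean_le_bound.
- exists M => w; apply: le_normr_Rintegral_bounded => // y.
  exact: mean_le_bound.
- apply: filterS2 dPt1 dPt2 => w.
  move=> /(random_embeddingP H measurable_singleton mk kM)[V1w _].
  move=> /(random_embeddingP H measurable_singleton mk kM)[_ ->];
  by rewrite V1w.
Qed.

Lemma kernel_covE (Pt1 Pt2 : Omega -> pprobability (borel X) R) :
  measurable_fun setT Pt1 -> measurable_fun setT Pt2 ->
  as_discrete P Pt1 -> as_discrete P Pt2 ->
  kernel_cov H P Pt1 Pt2 = \int[P]_w '[centered Pt1 w, centered Pt2 w].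
Proof.
move=> mPt1 mPt2 dPt1 dPt2; rewrite /kernel_cov/=.
by rewrite (ae_bounded_expectation (ae_bounded_dot_centered mPt1 mPt2 dPt1 dPt2)).
Qed.

Variables Pt1 Pt2 : Omega -> pprobability (borel X) R.

(** This is constancy of [a V1 - b V2] between [w] and [w0], with the terms crossed over so that all
    coefficients are nonnegative. *)
Lemma universal_embedding_combination (a b : R) (w w0 : Omega) :
  0 <= a -> 0 <= b ->
  discrete_measure (Pt1 w) -> discrete_measure (Pt1 w0) ->
  discrete_measure (Pt2 w) -> discrete_measure (Pt2 w0) ->
  a *: random_embedding H Pt1 w + b *: random_embedding H Pt2 w0 =
  a *: random_embedding H Pt1 w0 + b *: random_embedding H Pt2 w ->
  forall A : set (borel X), measurable A ->
    a * fine (Pt1 w A) + b * fine (Pt2 w0 A) =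
    a * fine (Pt1 w0 A) + b * fine (Pt2 w A).
Proof.
move=> a0 b0 d1 d10 d2 d20 VE A mA; have [M kM] := bounded_kernel.
have funV := random_embeddingP (Omega := Omega) H measurable_singleton mk kM.
apply: (universal_combination k_univ (a := NngNum a0) (b := NngNum b0)) => //= y.
have [e1 _] := funV _ _ d1; have [e10 _] := funV _ _ d10.
have [e2 _] := funV _ _ d2; have [e20 _] := funV _ _ d20.
have := congr1 (fun h => rkhs_fun H h y) VE.
by rewrite !linearD !linearZ /= e1 e10 e2 e20.
Qed.

End covariance.

(** * Positivity of the variances and the two implications *)

Section ae_equality.
Context (R : realType) (X : ptopologicalType) (k : X -> X -> R) (H : rkhs k).
Context d (Omega : measurableType d) (P : probability Omega R).
Hypothesis measurable_singleton : forall x : borel X, measurable [set x].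
Hypothesis k_univ : c0_universal k.

(** With variance 0, almost every [Pt w] equals one discrete measure [Pt w0]. Its point masses are
    then almost sure lower bounds, hence 0, contradicting total mass 1. *)
Lemma kernel_var_gt0 (Pt : Omega -> pprobability (borel X) R) :
  measurable_fun setT Pt -> as_discrete P Pt ->
  (forall z : X, fixed_atom P Pt z ->
     forall e : R, 0 < e -> (0 < P [set w | Pt w [set z] < e%:E])%E) ->
  0 < kernel_var H P Pt.
Proof.
move=> mPt dPt atoms; rewrite /kernel_var kernel_covE//.
have bc := ae_bounded_dot_centered H measurable_singleton k_univ mPt mPt dPt dPt.
rewrite lt_neqAle; apply/andP; split; last first.
  by apply: Rintegral_ge0 => w _; exact: rkhs_dot_ge0.
apply/eqP => /esym /(ae_bounded_Rintegral_eq0 bc (fun w => rkhs_dot_ge0 _)) V0.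
have {V0} [w0 [V0 d0] V0d] : exists2 w0,
    centered H P Pt w0 = 0 /\ discrete_measure (Pt w0) &
    {ae P, forall w, centered H P Pt w = 0 /\ discrete_measure (Pt w)}.
  have aeV : {ae P, forall w, centered H P Pt w = 0 /\ discrete_measure (Pt w)}.
    by apply: filterS2 V0 dPt => w /rkhs_dot_eq0.
  by have [w0] := ae_ex aeV; exists w0.
have [e [Pe _]] := discrete_measure_range measurable_singleton d0 d0.
have PtE : {ae P, forall w A, measurable A ->
    fine (Pt w A) = fine (Pt w0 A)}.
  apply: filterS V0d => w [Vw dw] A mA.
  have := @universal_embedding_combination _ _ _ H _ _ measurable_singleton
    k_univ Pt Pt 1 0 w w0 ler01 (lexx _) dw d0 dw d0.
  rewrite !scale1r !scale0r !addr0.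
  move/eqP: V0; rewrite subr_eq0 => /eqP ->.
  move/eqP: Vw; rewrite subr_eq0 => /eqP ->.
  by move=> /(_ erefl _ mA); rewrite !mul1r !mul0r !addr0.
(* The coefficients 1 and 0 suit [eq_probability_atoms], which on the whole space then yields 1 =
   0. *)
have atom0 z : 1 * fine (Pt w0 [set z]) = 0 * fine (Pt w0 [set z]).
  rewrite mul0r mul1r; apply/eqP; rewrite eq_le fine_ge0 ?measure_ge0// andbT.
  apply: (@atom_difference_le _ _ _ _ P measurable_singleton Pt mPt atoms Pt z
    1 0) => //.
  apply: filterS PtE => w /(_ _ (measurable_singleton z)) ->.
  by rewrite mul0r mul1r.
have := eq_probability_atoms measurable_singleton Pe Pe atom0 measurableT.
by rewrite probability_setT mul1r mul0r => /eqP; rewrite oner_eq0.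
Qed.

Variables Pt1 Pt2 : Omega -> pprobability (borel X) R.
Hypotheses (mPt1 : measurable_fun setT Pt1) (mPt2 : measurable_fun setT Pt2).
Hypotheses (dPt1 : as_discrete P Pt1) (dPt2 : as_discrete P Pt2).
Hypothesis Pt1_atoms : forall z : X, fixed_atom P Pt1 z ->
  forall e : R, 0 < e -> (0 < P [set w | Pt1 w [set z] < e%:E])%E.
Hypothesis Pt2_atoms : forall z : X, fixed_atom P Pt2 z ->
  forall e : R, 0 < e -> (0 < P [set w | Pt2 w [set z] < e%:E])%E.

Lemma ae_proportional_eq (a b : R) : 0 < a -> 0 < b ->
  {ae P, forall w, a *: centered H P Pt1 w = b *: centered H P Pt2 w} ->
  {ae P, forall w, eq_on_measurable (Pt1 w) (Pt2 w)}.
Proof.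
move=> a0 b0 Vae.
pose good w := [/\ discrete_measure (Pt1 w), discrete_measure (Pt2 w) &
  a *: centered H P Pt1 w = b *: centered H P Pt2 w].
have aegood : {ae P, forall w, good w} by apply: filterS3 dPt1 dPt2 Vae.
have comb w w0 : good w -> good w0 -> forall A : set (borel X), measurable A ->
    a * fine (Pt1 w A) + b * fine (Pt2 w0 A) =
    a * fine (Pt1 w0 A) + b * fine (Pt2 w A).
  move=> [d1 d2 Vw] [d10 d20 Vw0].
  apply: (@universal_embedding_combination _ _ _ H _ _ measurable_singleton
    k_univ Pt1 Pt2 a b w w0 (ltW a0) (ltW b0) d1 d10 d2 d20).
  (* The expectations do not depend on the outcome, so they cancel between [w] and [w0]. *)
  move: Vw Vw0; rewrite /centered !scalerBr.
  set m1 := a *: rkhs_expectation _ _; set m2 := b *: rkhs_expectation _ _.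
  move=> /eqP; rewrite subr_eq => /eqP -> /eqP; rewrite subr_eq => /eqP ->.
  by rewrite -!(addrA _ (- m2)) addrAC [RHS]addrAC; congr (_ + _); exact: addrC.
apply: filterS (aegood) => w0 gw0; have [d1 d2 _] := gw0.
have [e [Pe1 Pe2]] := discrete_measure_range measurable_singleton d1 d2.
(* With [w0] fixed, [comb] holds for almost every [w]; bounding the mass under [Pt1] gives one
   inequality and exchanging the roles of [Pt1] and [Pt2] gives the other. *)
have atoms z : a * fine (Pt1 w0 [set z]) = b * fine (Pt2 w0 [set z]).
  have mz : measurable [set z] by exact: measurable_singleton.
  apply/eqP; rewrite eq_le; apply/andP; split.
    apply: (@atom_difference_le _ _ _ _ P measurable_singleton Pt1 mPt1
      Pt1_atoms Pt2 z a b _ _ a0 (ltW b0)).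
    by apply: filterS (aegood) => w gw; exact: comb.
  apply: (@atom_difference_le _ _ _ _ P measurable_singleton Pt2 mPt2
    Pt2_atoms Pt1 z b a _ _ b0 (ltW a0)).
  apply: filterS (aegood) => w gw.
  by rewrite addrC -(comb w w0)// addrC.
have PQ := eq_probability_atoms measurable_singleton Pe1 Pe2 atoms.
have ab : a = b.
  have := PQ _ measurableT.
  rewrite [X in fine X]probability_setT [X in _ = _ * fine X]probability_setT.
  by rewrite !mulr1.
move=> A mA; rewrite -[LHS]fineK ?fin_num_measure// -[RHS]fineK ?fin_num_measure//.
congr EFin; apply: (mulfI (lt0r_neq0 a0)).
by rewrite PQ// ab.
Qed.

(** A kernel mean sees a measure only through its values on measurable sets, so the two embeddings
    agree almost surely. *)
Lemma ae_eq_kernel_cov :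
  {ae P, forall w, eq_on_measurable (Pt1 w) (Pt2 w)} ->
  kernel_cov H P Pt1 Pt2 = kernel_var H P Pt1 /\
  kernel_var H P Pt2 = kernel_var H P Pt1.
Proof.
move=> PQ.
have V12 : {ae P, forall w, random_embedding H Pt1 w = random_embedding H Pt2 w}.
  apply: filterS PQ => w PQw; rewrite /random_embedding /mean_embedding.
  suff -> : kernel_mean k (charge_of_finite_measure (Pt1 w)) =
    kernel_mean k (charge_of_finite_measure (Pt2 w)) by [].
  apply/funext => y; rewrite /kernel_mean !charge_integral_measure.
  by congr fine; apply: eq_measure_integral => A mA _; exact: PQw.
have m12 : rkhs_expectation P (random_embedding H Pt1) =
    rkhs_expectation P (random_embedding H Pt2).
  (* Both expectations are chosen from the same set of vectors, so they coincide even if the default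
     value is taken. *)
  rewrite /rkhs_expectation; congr xget; apply/seteqP; split => m /= mE h;
    by rewrite mE unlock; apply: ae_eq_integralT; apply: filterS V12 => w ->.
rewrite /kernel_var /kernel_cov; split; congr fine; rewrite unlock;
  by apply: ae_eq_integralT; apply: filterS V12 => w; rewrite m12 => ->.
Qed.

End ae_equality.

Theorem theorem6 (R : realType) (X : ptopologicalType)
  (X_polish : polish R X) (X_lc : locally_compact [set: X])
  (k : X -> X -> R) (k_univ : c0_universal k) (H : rkhs k)
  (d : measure_display) (Omega : measurableType d) (P : probability Omega R)
  (Pt1 Pt2 : Omega -> pprobability (borel X) R)
  (mPt1 : measurable_fun [set: Omega] Pt1)
  (mPt2 : measurable_fun [set: Omega] Pt2)
  (Pt1_discrete : as_discrete P Pt1)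
  (Pt2_discrete : as_discrete P Pt2)
  (Pt1_atoms : forall z : X, fixed_atom P Pt1 z ->
     forall e : R, 0 < e -> (0 < P [set w | Pt1 w [set z] < e%:E])%E)
  (Pt2_atoms : forall z : X, fixed_atom P Pt2 z ->
     forall e : R, 0 < e -> (0 < P [set w | Pt2 w [set z] < e%:E])%E) :
  kernel_corr H P Pt1 Pt2 = 1 <->
  {ae P, forall w, eq_on_measurable (Pt1 w) (Pt2 w)}.
Proof.
have ms := polish_measurable_singleton X_polish.
have v1 := kernel_var_gt0 H ms k_univ mPt1 Pt1_discrete Pt1_atoms.
have v2 := kernel_var_gt0 H ms k_univ mPt2 Pt2_discrete Pt2_atoms.
have s1 : 0 < Num.sqrt (kernel_var H P Pt1) by rewrite sqrtr_gt0.
have s2 : 0 < Num.sqrt (kernel_var H P Pt2) by rewrite sqrtr_gt0.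
(* A quotient equal to 1 has equal numerator and denominator, which is the equality case of
   Cauchy-Schwarz for the centred embeddings. *)
rewrite /kernel_corr; split=> [/divr1_eq cov1|].
  have := rkhs_expectation_cauchy_schwarz_eq
    (ae_bounded_dot_centered H ms k_univ mPt1 mPt1 Pt1_discrete Pt1_discrete)
    (ae_bounded_dot_centered H ms k_univ mPt1 mPt2 Pt1_discrete Pt2_discrete)
    (ae_bounded_dot_centered H ms k_univ mPt2 mPt2 Pt2_discrete Pt2_discrete).
  rewrite -!(kernel_covE H ms k_univ)// => /(_ cov1).
  exact: (ae_proportional_eq ms k_univ mPt1 mPt2 Pt1_discrete Pt2_discrete
    Pt1_atoms Pt2_atoms s2 s1).
move=> /(ae_eq_kernel_cov H)[c12 v21].
by rewrite c12 v21 -expr2 sqr_sqrtr ?(ltW v1)// divff// gt_eqF.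
Qed.
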